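(* Let $\mathcal{M}$ be a concurrent game model, $q$ a state of $\mathcal{M}$ and $\varphi$ an ATL-formula. Then $\mathcal{M},q\models^g_u\varphi$ if and only if $\mathcal{M},q\models^g_b\varphi$.
   Context: A concurrent game model (CGM) is $\mathcal{M}=(\mathrm{Agt},\mathrm{St},\Pi,\mathrm{Act},d,o,v)$: $\mathrm{Agt}=\{1,\dots,k\}$ agents; nonempty sets $\mathrm{St}$ (states), $\Pi$ (proposition symbols), $\mathrm{Act}$ (actions); $d:\mathrm{Agt}\times\mathrm{St}\to\mathcal{P}(\mathrm{Act})\setminus\{\emptyset\}$; $o$ assigns to each state $q$ and each action profile $(\alpha_1,\dots,\alpha_k)$ with $\alpha_i\in d(i,q)$ an outcome state; $v:\Pi\to\mathcal{P}(\mathrm{St})$. For $A\subseteq\mathrm{Agt}$, $\overline{A}=\mathrm{Agt}\setminus A$ and $\mathrm{action}(A,q)$ is the set of tuples $(\alpha_i)_{i\in A}$ with $\alpha_i\in d(i,q)$. ATL formulae: $\varphi::=p\mid\neg\varphi\mid(\varphi\vee\varphi)\mid\langle\!\langle A\rangle\!\rangle\mathsf{X}\varphi\mid\langle\!\langle A\rangle\!\rangle\varphi\,\mathsf{U}\,\varphi\mid\langle\!\langle A\rangle\!\rangle\varphi\,\mathsf{R}\,\varphi$. Players: Eloise $\mathbf{E}$, Abelard $\mathbf{A}$; $\overline{\mathbf{P}}$ is the opponent of $\mathbf{P}$. One step game $\mathrm{step}(\mathbf{P},A,q)$: $\mathbf{P}$ picks a tuple in $\mathrm{action}(A,q)$,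 then $\overline{\mathbf{P}}$ picks a tuple in $\mathrm{action}(\overline{A},q)$; the resulting state is the outcome of the combined profile. Unbounded evaluation game $\mathcal{G}(\mathcal{M},q_{in},\varphi)$: positions $(\mathbf{P},q,\psi)$ with $\psi$ a subformula of $\varphi$; start $(\mathbf{E},q_{in},\varphi)$. At $(\mathbf{P},q,p)$ the game ends, $\mathbf{P}$ wins iff $q\in v(p)$, else $\overline{\mathbf{P}}$ wins. $(\mathbf{P},q,\neg\psi)\to(\overline{\mathbf{P}},q,\psi)$. At $(\mathbf{P},q,\psi\vee\theta)$, $\mathbf{P}$ chooses $(\mathbf{P},q,\psi)$ or $(\mathbf{P},q,\theta)$. At $(\mathbf{P},q,\langle\!\langle A\rangle\!\rangle\mathsf{X}\psi)$, $\mathrm{step}(\mathbf{P},A,q)$ gives $q'$, next $(\mathbf{P},q',\psi)$. At $(\mathbf{P},q,\langle\!\langle A\rangle\!\rangle\psi\mathsf{U}\theta)$ the embedded game $\mathbf{g}(\mathbf{P},\mathbf{P},A,q,\theta,\psi)$ is played; at $(\mathbf{P},q,\langle\!\langle A\rangle\!\rangle\psi\mathsf{R}\theta)$ the embedded game $\mathbf{g}(\mathbf{P},\overline{\mathbf{P}},A,q,\theta,\psi)$. An embedded game $\mathbf{g}(\mathbf{V},\mathbf{C},A,q_0,\psi_{\mathbf{C}},\psi_{\overline{\mathbf{C}}})$ (verifier $\mathbf{V}$, controller $\mathbf{C}$) proceeds from $q_0$; at current state $q$: (i) $\mathbf{C}$ may end it at exit position $(\mathbf{V},q,\psi_{\mathbf{C}})$;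 (ii) $\overline{\mathbf{C}}$ may end it at $(\mathbf{V},q,\psi_{\overline{\mathbf{C}}})$; (iii) otherwise $\mathrm{step}(\mathbf{V},A,q)$ gives $q'$ and play continues from $q'$. If it lasts infinitely many rounds, $\mathbf{C}$ loses the evaluation game; otherwise the evaluation game continues from the exit position. $\Gamma$-bounded evaluation game $\mathcal{G}(\mathcal{M},q_{in},\varphi,\Gamma)$ ($\Gamma$ an ordinal): identical except in embedded games: $\mathbf{C}$ first chooses an ordinal $\gamma_0<\Gamma$; play goes through configurations $(\gamma,q)$ from $(\gamma_0,q_0)$ with rules in order: (i) if $\gamma=0$ end at $(\mathbf{V},q,\psi_{\mathbf{C}})$; (ii) $\mathbf{C}$ may end at $(\mathbf{V},q,\psi_{\mathbf{C}})$; (iii) $\overline{\mathbf{C}}$ may end at $(\mathbf{V},q,\psi_{\overline{\mathbf{C}}})$; (iv) otherwise $\mathrm{step}(\mathbf{V},A,q)$ gives $q'$, continue from $(\gamma',q')$ with $\gamma'=\gamma-1$ if $\gamma$ is a successor and $\gamma'<\gamma$ chosen by $\mathbf{C}$ if $\gamma$ is a limit. Strategies: a player's strategy specifies disjunct choices, tuples of actions (as verifier) or response functions $\mathrm{action}(A,q)\to\mathrm{action}(\overline{A},q)$ (as falsifier) in one step games, and, for each until/release position, a strategy for the embedded game: in the unbounded game this embedded strategy depends only on the current state (giving, at each state, either ''end the game'' as permitted by the player's role, or an action tuple / response function); in the $\Gamma$-bounded game the controller picks $\gamma_0<\Gamma$, a timer $t$ (with $t(\gamma,q)<\gamma$ for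 limit $\gamma$, giving the new time limit when the limit is $\gamma$ and the new state is $q$) and an embedded strategy depending on configurations $(\gamma,q)$, while the non-controller picks for each $\gamma_0<\Gamma$ an embedded strategy depending on configurations. A winning strategy wins all plays consistent with it. $\mathcal{M},q\models^g_u\varphi$ iff $\mathbf{E}$ has a winning strategy in $\mathcal{G}(\mathcal{M},q,\varphi)$; $\mathcal{M},q\models^g_b\varphi$ iff $\mathbf{E}$ has a winning strategy in $\mathcal{G}(\mathcal{M},q,\varphi,2^\kappa)$, where $\kappa$ is the cardinality of $\mathcal{M}$. *)

(* Defs.v *)
From HB Require Import structures.
From mathcomp Require Import all_boot.
From mathcomp Require Import boolp classical_sets functions cardinality wochoice.

Set Implicit Arguments.
Unset Strict Implicit.
Unset Printing Implicit Defensive.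

Local Open Scope classical_set_scope.
Local Open Scope card_scope.

(** * Ordinals *)

(* An ordinal is represented by a well-ordered type: the elements of
   [G : wotype] are the ordinals below [G]. *)
Record wotype := WOType {
  wo_car :> Type;
  wo_lt : wo_car -> wo_car -> Prop;
  wo_wf : well_founded wo_lt;
  wo_trans : forall x y z, wo_lt x y -> wo_lt y z -> wo_lt x z;
  wo_total : forall x y, wo_lt x y \/ x = y \/ wo_lt y x }.

Section Ordinals.
Variable G : wotype.
Implicit Types c d e : G.

Definition is_zero c := forall d, ~ wo_lt d c.

Definition is_succ_of c d :=
  wo_lt d c /\ forall e, wo_lt e c -> e = d \/ wo_lt e d.

Definition is_limit c := ~ is_zero c /\ ~ exists d, is_succ_of c d.
End Ordinals.

(* [G] is the cardinal [2 ^ card T], i.e. the initial ordinal equinumerous with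
   the powerset of [T]. *)
Definition is_pow_ordinal (T : Type) (G : wotype) : Prop :=
  [set: G] #= [set: set T] /\
  forall c : G, ~ ([set: G] #<= [set d : G | wo_lt d c]).

Lemma exists_wotype_on (T : Type) : exists G : wotype, wo_car G = T.
Proof.
have [R woR] := well_ordering_principle {classic T}.
have tot : total R.
  by move=> x y; apply: (wo_chainW (C := predT) (withinW woR)).
have anti : antisymmetric R by by move=> x y xy; exact: (wo_chain_antisymmetric (C := predT) (withinW woR)).
have refl : reflexive R by move=> x; have := tot x x; rewrite orbb.
pose lt (x y : T) := R x y /\ x <> y.
have wf : well_founded lt.
  move=> x; apply: contrapT => nx.
  pose A : {pred {classic T}} := fun z => `[< ~ Acc lt z >].
  have [|m [[mA mlb] _]] := woR A; first by exists x; apply/asboolP.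
  move/asboolP: (mA); apply; constructor => y [Rym nym].
  apply: contrapT => ny; apply: nym; apply: anti.
  by rewrite Rym mlb //; apply/asboolP.
have Tot x y : lt x y \/ x = y \/ lt y x.
  have [|ne] := pselect (x = y); first by right; left.
  have /orP[Rxy|Ryx] := tot x y; first by left.
  by right; right; split=> // /esym.
have key a b c : R a b -> R b c -> R a c.
  move=> Rab Rbc.
  pose A : {pred {classic T}} := fun z => `[< z = a \/ z = b \/ z = c >].
  have [|m [[mA mlb] _]] := woR A.
    by exists a; apply/asboolP; left.
  have Ra : R m a by apply: mlb; apply/asboolP; left.
  have Rb : R m b by apply: mlb; apply/asboolP; right; left.
  have Rc : R m c by apply: mlb; apply/asboolP; right; right.
  move/asboolP: mA => [e|[e|e]].
  - by rewrite -e.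
  - by have -> : a = b by apply: anti; rewrite Rab -e.
  - have ebc : b = c by apply: anti; rewrite Rbc -e.
    by rewrite -ebc.
have Tr x y z : lt x y -> lt y z -> lt x z.
  move=> [Rxy nxy] [Ryz nyz]; split; first exact: key Ryz.
  by move=> exz; apply: nxy; apply: anti; rewrite Rxy exz.
by exists (WOType wf Tr Tot).
Qed.

Lemma exists_pow_ordinal (T : Type) : exists G, is_pow_ordinal T G.
Proof.
have [G eG] := exists_wotype_on (set T).
have cG : [set: G] #= [set: set T] by rewrite eG.
have [[c0 Pc0]|noc] :=
    pselect (exists c : G, [set: G] #<= [set d : G | wo_lt d c]); last first.
  by exists G; split=> // c Hc; apply: noc; exists c.
have [c [Pc minc]] : exists c : G, [set: G] #<= [set d : G | wo_lt d c] /\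
    forall e, wo_lt e c -> ~ ([set: G] #<= [set d : G | wo_lt d e]).
  elim: (wo_wf c0) Pc0 => x _ IH Px.
  have [[e [ex Pe]]|H] := pselect (exists e, wo_lt e x /\
      [set: G] #<= [set d : G | wo_lt d e]); first exact: IH ex Pe.
  by exists x; split=> // e ex Pe; apply: H; exists e.
pose H := {d : G | wo_lt d c}.
pose ltH (x y : H) := wo_lt (sval x) (sval y).
have wfH : well_founded ltH.
  have acc d : forall h : H, sval h = d -> Acc ltH h.
    elim: (wo_wf d) => x _ IH h hx; constructor => y.
    by rewrite /ltH hx => /IH; apply.
  by move=> h; apply: acc.
have svI (x y : H) : sval x = sval y -> x = y.
  by case: x y => [x hx] [y hy] /= exy; subst y; congr exist; exact: Prop_irrelevance.
have trH x y z : ltH x y -> ltH y z -> ltH x z by exact: wo_trans.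
have totH x y : ltH x y \/ x = y \/ ltH y x.
  by have [|[/svI|]] := wo_total (sval x) (sval y); [left|right; left|right; right].
pose W := WOType wfH trH totH.
have imS (B : set H) : (fun x : H => sval x) @` B #= B.
  by apply: inj_card_eq => x y _ _; exact: svI.
have cH : [set: H] #= [set: G].
  rewrite -(card_eql (imS _)) card_eq_le subset_card_le //=.
  apply: card_le_trans Pc _; apply: subset_card_le => d dc.
  by exists (exist _ d dc).
exists W; split; first exact: card_eq_trans cH cG.
move=> [e ec] leW; apply: (minc e ec).
have cGH : [set: G] #<= [set: H] by move: cH; rewrite card_eq_le => /andP[].
apply: card_le_trans cGH _; apply: card_le_trans leW _.
rewrite -(card_le_eql (imS _)); apply: subset_card_le.
by move=> _ [y /= ye <-].
Qed.

Definition pow_ordinal (T : Type) : wotype := sval (cid (exists_pow_ordinal T)).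

Lemma pow_ordinalP (T : Type) : is_pow_ordinal T (pow_ordinal T).
Proof. exact: svalP (cid (exists_pow_ordinal T)). Qed.

(** * Concurrent game models and ATL *)

Record cgm := CGM {
  nagt : nat;
  St : Type;
  Prp : Type;
  Act : Type;
  St_inhabited : inhabited St;
  Prp_inhabited : inhabited Prp;
  Act_inhabited : inhabited Act;
  avail : 'I_nagt -> St -> set Act;
  avail_nonempty : forall i q, avail i q !=set0;
  out : forall q : St, (forall i : 'I_nagt, {a : Act | avail i q a}) -> St;
  valuation : Prp -> set St }.

Inductive formula (M : cgm) : Type :=
  | Var of Prp M
  | Neg of formula M
  | Or of formula M & formula M
  | Next of {set 'I_(nagt M)} & formula M
  | Until of {set 'I_(nagt M)} & formula M & formula M
  | Release of {set 'I_(nagt M)} & formula M & formula M.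

Variant player := Eloise | Abelard.

Definition opp (P : player) : player :=
  match P with Eloise => Abelard | Abelard => Eloise end.

Definition eq_player (P Q : player) : bool :=
  match P, Q with
  | Eloise, Eloise | Abelard, Abelard => true
  | _, _ => false
  end.

Lemma eq_playerP : Equality.axiom eq_player.
Proof. by move=> [] []; constructor. Qed.

HB.instance Definition _ := hasDecEq.Build player eq_playerP.

(* The part a player has in a one step game. *)
Variant role := Verifier | Falsifier.

Section Games.
Variable M : cgm.
Notation agt := 'I_(nagt M).
Notation fml := (formula M).
Implicit Types (A : {set agt}) (q : St M) (f g : fml) (P Q : player).

(** * One step games *)

Definition action (A : {set agt}) (q : St M) : Type :=
  forall i : agt, i \in A -> {a : Act M | avail i q a}.

Definition response (A : {set agt}) (q : St M) : Type :=
  action A q -> action (~: A) q.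

Definition step_choice (r : role) (A : {set agt}) (q : St M) : Type :=
  match r with Verifier => action A q | Falsifier => response A q end.

Lemma notin_setC A (i : agt) : (i \in A) = false -> i \in ~: A.
Proof. by rewrite finset.in_setC => ->. Qed.

Definition joint A q (a : action A q) (b : action (~: A) q) (i : agt) :
    {x : Act M | avail i q x} :=
  (if i \in A as t return (i \in A) = t -> {x : Act M | avail i q x}
   then fun h => a i h else fun h => b i (notin_setC h)) erefl.

Definition step_outcome A q
    (a : step_choice Verifier A q) (r : step_choice Falsifier A q) : St M :=
  out (joint a (r a)).

(** * Positions and the rules outside embedded games *)

Record position := Pos { owner : player; state : St M; fmla : fml }.

(* The embedded game g(V, C, A, q0, psi_C, psi_{opp C}). *)
Record embgame := EmbGame {
  verifier : player;
  controller : player;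
  coalition : {set agt};
  start : St M;
  ctl_fml : fml;
  opp_fml : fml }.

Definition embedded_at (x : position) : option embgame :=
  let: Pos P q f := x in
  match f with
  | Until A g h => Some (EmbGame P P A q h g)
  | Release A g h => Some (EmbGame P (opp P) A q h g)
  | _ => None
  end.

(* The part of a player's strategy which concerns disjunctions and next-time
   formulae; [st_disj] selects the left disjunct when it is [true]. *)
Record base_strategy := BaseStrategy {
  st_disj : St M -> fml -> fml -> bool;
  st_next : forall (r : role) (A : {set agt}) (q : St M), fml -> step_choice r A q }.

(* The move [m] made by player [Q] is one that can occur in a play consistent
   with a strategy of player [P] prescribing [s]; the opponent is free. *)
Definition follows (P Q : player) (T : Type) (s m : T) : Prop := Q = P -> m = s.

Inductive base_step (P : player) (S : base_strategy) :
    position -> position -> Prop :=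
  | step_neg Q q f :
      base_step P S (Pos Q q (Neg f)) (Pos (opp Q) q f)
  | step_or Q q f g (b : bool) :
      follows P Q (st_disj S q f g) b ->
      base_step P S (Pos Q q (Or f g)) (Pos Q q (if b then f else g))
  | step_next Q q A f a r :
      follows P Q (st_next S Verifier A q f) a ->
      follows P (opp Q) (st_next S Falsifier A q f) r ->
      base_step P S (Pos Q q (Next A f)) (Pos Q (step_outcome a r) f).

Definition wins_atom (P Q : player) (q : St M) (p : Prp M) : Prop :=
  if Q == P then valuation p q else ~ valuation p q.

(** * Rounds of embedded games *)

(* [None] means ending the embedded game. *)
Definition emb_move (r : role) (A : {set agt}) (q : St M) : Type :=
  option (step_choice r A q).

Definition exit_fml (e : embgame) (Q : player) : fml :=
  if Q == controller e then ctl_fml e else opp_fml e.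

(* The exit formula or the next state; the controller has precedence when both
   players want to end the embedded game. *)
Definition round_result (e : embgame) (q : St M)
    (mv : emb_move Verifier (coalition e) q)
    (mf : emb_move Falsifier (coalition e) q) : fml + St M :=
  match mv, mf with
  | Some a, Some r => inr (step_outcome a r)
  | None, Some _ => inl (exit_fml e (verifier e))
  | Some _, None => inl (exit_fml e (opp (verifier e)))
  | None, None => inl (ctl_fml e)
  end.

(** * Plays *)

Definition finite_play (X : Type) (step : X -> X -> Prop) (x : X)
    (h : nat -> X) (n : nat) : Prop :=
  h 0 = x /\ forall i, i < n -> step (h i) (h i.+1).

Definition infinite_play (X : Type) (step : X -> X -> Prop) (x : X)
    (h : nat -> X) : Prop :=
  h 0 = x /\ forall i, step (h i) (h i.+1).

(** * The unbounded evaluation game *)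

Inductive uconf := UPos of position | UEmb of embgame & St M.

Record ustrategy := UStrategy {
  u_base :> base_strategy;
  u_emb : forall (r : role) (e : embgame) (q : St M), emb_move r (coalition e) q }.

Inductive ustep (P : player) (S : ustrategy) : uconf -> uconf -> Prop :=
  | ustep_base x y :
      base_step P S x y -> ustep P S (UPos x) (UPos y)
  | ustep_enter x e :
      embedded_at x = Some e -> ustep P S (UPos x) (UEmb e (start e))
  | ustep_round e q mv mf :
      follows P (verifier e) (u_emb S Verifier e q) mv ->
      follows P (opp (verifier e)) (u_emb S Falsifier e q) mf ->
      ustep P S (UEmb e q)
        match round_result mv mf with
        | inl f => UPos (Pos (verifier e) q f)
        | inr q' => UEmb e q'
        end.

(* An infinite play stays from some point on in one embedded game, which is then
   lost by its controller. *)
Definition uwinning (P : player) (S : ustrategy) (q : St M) (f : fml) : Prop :=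
  let init := UPos (Pos Eloise q f) in
  (forall h n, finite_play (ustep P S) init h n ->
     forall Q q' p, h n = UPos (Pos Q q' (Var p)) -> wins_atom P Q q' p) /\
  (forall h, infinite_play (ustep P S) init h ->
     exists e N, (forall i, N <= i -> exists q', h i = UEmb e q') /\
                 controller e = opp P).

(** * The bounded evaluation game *)

Section Bounded.
Variable G : wotype.
Implicit Types c d : G.

(* [BEmb e c0 c q]: the embedded game [e], begun with time limit [c0], is at
   configuration [(c, q)]. *)
Inductive bconf := BPos of position | BEmb of embgame & G & G & St M.

(* [b_limit], [b_timer] and [b_ctl] are used in the embedded games controlled by
   the player, [b_opp] (whose first argument in [G] is the initial time limit
   chosen by the opponent) in those which the player does not control. *)
Record bstrategy := BStrategy {
  b_base :> base_strategy;
  b_limit : embgame -> G;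
  b_timer : embgame -> G -> St M -> G;
  b_timer_lt : forall e c q, is_limit c -> wo_lt (b_timer e c q) c;
  b_ctl : forall (r : role) (e : embgame), G ->
    forall q, emb_move r (coalition e) q;
  b_opp : forall (r : role) (e : embgame), G -> G ->
    forall q, emb_move r (coalition e) q }.

Definition b_emb (P : player) (S : bstrategy) (r : role) (e : embgame)
    (c0 c : G) (q : St M) : emb_move r (coalition e) q :=
  if P == controller e then b_ctl S r e c q else b_opp S r e c0 c q.

Inductive bstep (P : player) (S : bstrategy) : bconf -> bconf -> Prop :=
  | bstep_base x y :
      base_step P S x y -> bstep P S (BPos x) (BPos y)
  | bstep_enter x e c0 :
      embedded_at x = Some e ->
      follows P (controller e) (b_limit S e) c0 ->
      bstep P S (BPos x) (BEmb e c0 c0 (start e))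
  | bstep_zero e c0 c q :
      is_zero c ->
      bstep P S (BEmb e c0 c q) (BPos (Pos (verifier e) q (ctl_fml e)))
  | bstep_exit e c0 c q mv mf f :
      ~ is_zero c ->
      follows P (verifier e) (b_emb P S Verifier e c0 c q) mv ->
      follows P (opp (verifier e)) (b_emb P S Falsifier e c0 c q) mf ->
      round_result mv mf = inl f ->
      bstep P S (BEmb e c0 c q) (BPos (Pos (verifier e) q f))
  | bstep_succ e c0 c q mv mf q' c' :
      follows P (verifier e) (b_emb P S Verifier e c0 c q) mv ->
      follows P (opp (verifier e)) (b_emb P S Falsifier e c0 c q) mf ->
      round_result mv mf = inr q' ->
      is_succ_of c c' ->
      bstep P S (BEmb e c0 c q) (BEmb e c0 c' q')
  | bstep_limit e c0 c q mv mf q' c' :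
      follows P (verifier e) (b_emb P S Verifier e c0 c q) mv ->
      follows P (opp (verifier e)) (b_emb P S Falsifier e c0 c q) mf ->
      round_result mv mf = inr q' ->
      is_limit c -> wo_lt c' c ->
      follows P (controller e) (b_timer S e c q') c' ->
      bstep P S (BEmb e c0 c q) (BEmb e c0 c' q').

(* All plays are finite since time limits decrease. *)
Definition bwinning (P : player) (S : bstrategy) (q : St M) (f : fml) : Prop :=
  forall h n, finite_play (bstep P S) (BPos (Pos Eloise q f)) h n ->
    forall Q q' p, h n = BPos (Pos Q q' (Var p)) -> wins_atom P Q q' p.

End Bounded.

(** * Game-theoretic satisfaction *)

Definition sat_u (q : St M) (f : fml) : Prop :=
  exists S : ustrategy, uwinning Eloise S q f.

(* The cardinality of a model is that of its set of states. *)
Definition sat_b (q : St M) (f : fml) : Prop :=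
  exists S : bstrategy (pow_ordinal (St M)), bwinning Eloise S q f.

End Games.

(* Main.v *)
From mathcomp Require Import all_boot zify.
From mathcomp Require Import boolp classical_sets cardinality.
Require Import Defs.

Set Implicit Arguments.
Unset Strict Implicit.
Unset Printing Implicit Defensive.

Local Open Scope classical_set_scope.
Local Open Scope card_scope.

(** Both notions of satisfaction agree with a set [win] of positions defined by
    recursion on formulae: an embedded game is won by Eloise on the least fixed
    point of a one-round operator if she controls it, and on the greatest fixed
    point otherwise.  The transfinite stages of a monotone operator on subsets of
    [St] must stabilise below [2 ^ card St], for otherwise picking a new state at
    each stage would inject [2 ^ card St] into [St], against Cantor.  Hence, in
    the least fixed point, the stage at which a state appears is an admissible
    time limit, and a positional strategy which decreases it wins both games;
    dually, surviving all time limits means being in the greatest fixed point. *)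

(** * Fixed points and their stages *)

Lemma wo_irr (G : wotype) (c : G) : ~ wo_lt c c.
Proof. by elim: (wo_wf c) => d _ IH dd; exact: (IH d dd dd). Qed.

Lemma wo_lt_le_trans (G : wotype) (a b c : G) :
  wo_lt a b -> ~ wo_lt c b -> wo_lt a c.
Proof.
by move=> ab ncb; have [/(wo_trans ab)|[<-|]] := wo_total b c.
Qed.

Section FixedPoints.
Variable T : Type.
Implicit Types (F : set T -> set T) (X Y Z : set T).

Definition monotone F := forall X Y, X `<=` Y -> F X `<=` F Y.

Definition lfp F : set T := [set t | forall Z, F Z `<=` Z -> Z t].

Definition gfp F : set T := [set t | exists2 Z, Z `<=` F Z & Z t].

(** Conjugation by complement: the stages of [dual F] are the complements of the decreasing
    approximations of [gfp F]. *)
Definition dual F X : set T := ~` F (~` X).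

Lemma monotone_dual F : monotone F -> monotone (dual F).
Proof.
move=> mF X Y XY t nF FY; apply: nF; apply: mF FY => s nY Xs; exact/nY/XY.
Qed.

Lemma lfp_closed F : monotone F -> F (lfp F) `<=` lfp F.
Proof. by move=> mF t Ft Z FZ; apply: (FZ); apply: mF Ft => s; apply. Qed.

Lemma gfp_unfold F : monotone F -> gfp F `<=` F (gfp F).
Proof.
by move=> mF t [Z ZF Zt]; apply: mF (ZF _ Zt) => s Zs; exists Z.
Qed.

Variable G : wotype.

(** Stage zero is [F set0], not [set0]. In a game controlled by Eloise it thus holds the states she
    wins by ending at once, which fits the forced exit at time limit zero. *)
Definition stage F : G -> set T :=
  Fix (wo_wf (w := G)) (fun=> set T)
    (fun c rec => F [set t | exists d (dc : wo_lt d c), rec d dc t]).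

Definition below F (c : G) : set T := [set t | exists2 d, wo_lt d c & stage F d t].

Lemma stageE F c : stage F c = F (below F c).
Proof.
rewrite /stage Fix_eq.
  congr F; apply/seteqP; split=> t /=; first by case=> d [dc dt]; exists d.
  by case=> d dc dt; exists d, dc.
move=> d f g fg; congr F; apply/seteqP; split=> t /= [e [ed et]]; exists e, ed.
  by rewrite -fg.
by rewrite fg.
Qed.

Variable F : set T -> set T.
Hypothesis mF : monotone F.

Lemma stage_le (c d : G) : ~ wo_lt d c -> stage F c `<=` stage F d.
Proof.
move=> ndc; rewrite !stageE; apply: mF => t [e ec et]; exists e => //.
exact: wo_lt_le_trans ec ndc.
Qed.

Lemma stage_lfp (c : G) : stage F c `<=` lfp F.
Proof.
elim: (wo_wf c) => {}c _ IH; rewrite stageE => t Ft.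
by apply: lfp_closed => //; apply: mF Ft => s [d dc]; apply: IH.
Qed.

Hypothesis no_inj : forall g : G -> T, ~ injective g.

Lemma stage_stabilises : exists c : G, stage F c `<=` below F c.
Proof.
apply: contrapT => nst.
have new c : exists t, stage F c t /\ ~ below F c t.
  apply: contrapT => nt; apply: nst; exists c => t ct.
  by apply: contrapT => nb; apply: nt; exists t.
have [g gP] := choice new.
have ne c d : wo_lt c d -> g c <> g d.
  by move=> cd e; case: (gP d) => _; apply; rewrite -e; exists c => //; case: (gP c).
apply: (no_inj (g := g)) => c d e.
have [/ne|[//|/ne/nesym]] := wo_total c d; by move/(_ e).
Qed.

(** All stages lie below a stage [c] that adds nothing new, so [F] maps their union into
    [stage F c]. *)
Lemma stages_closed :
  F [set t | exists c : G, stage F c t] `<=` [set t | exists c : G, stage F c t].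
Proof.
have [c cP] := stage_stabilises.
have sub (d : G) : stage F d `<=` below F c.
  elim: (wo_wf d) => {}d _ IH.
  have [dc|[->//|cd]] := wo_total d c; first by move=> t dt; exists d.
  rewrite stageE => t Ft; apply: cP; rewrite stageE.
  by apply: mF Ft => s [e ed]; apply: IH.
move=> t Ft; exists c; rewrite stageE; apply: mF Ft => s [d]; exact: sub.
Qed.

Lemma lfp_stage t : lfp F t -> exists c : G, stage F c t.
Proof. by move=> /(_ _ stages_closed). Qed.

Lemma lfp_least_stage t : lfp F t ->
  exists c : G, stage F c t /\ forall d, stage F d t -> ~ wo_lt d c.
Proof.
case/lfp_stage => c; elim: (wo_wf c) => {}c _ IH ct.
have [[d [dc dt]]|min] := pselect (exists d, wo_lt d c /\ stage F d t).
  exact: IH dc dt.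
by exists c; split=> // d dt dc; apply: min; exists d.
Qed.
End FixedPoints.

(** The union of the dual stages is closed under [dual F], hence its complement is a post-fixed
    point of [F]. *)
Lemma gfp_stage (T : Type) (G : wotype) (F : set T -> set T) t :
  monotone F -> (forall g : G -> T, ~ injective g) ->
  (forall c : G, ~ stage (dual F) c t) -> gfp F t.
Proof.
move=> mF no_inj nt.
exists (~` [set s | exists c : G, stage (dual F) c s]); last by case=> c /nt.
move=> s ns; apply: contrapT => nF; apply: ns.
exact: stages_closed (monotone_dual mF) no_inj s nF.
Qed.

Lemma pow_ordinal_no_inj (T : Type) (g : pow_ordinal T -> T) : ~ injective g.
Proof.
move=> ginj; have [/card_set_bijP[f [_ _ fsurj]] _] := pow_ordinalP T.
(* Cantor's diagonal set; injectivity of [g] recovers the index [c] from the point [g c]. *)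
pose D := [set t | exists2 c, g c = t & ~ f c t].
have [c _ fc] := fsurj D I.
have nD : ~ D (g c) by move=> /[dup] Dg [d /ginj -> ]; rewrite fc.
by apply: nD; exists c => //; rewrite fc => Dg; case: (Dg) => d /ginj ->; rewrite fc.
Qed.

Lemma pow_ordinal_inhabited (T : Type) : inhabited (pow_ordinal T).
Proof.
have [/card_set_bijP[f [_ _ fsurj]] _] := pow_ordinalP T.
by have [c _ _] := fsurj set0 I.
Qed.

(** * Plays *)

Section Plays.
Variables (X : Type) (step : X -> X -> Prop).

Definition reachable (x y : X) := exists h n, finite_play step x h n /\ h n = y.

Lemma reachable_refl x : reachable x x.
Proof. by exists (fun=> x), 0. Qed.

Lemma reachable_step x y z : reachable x y -> step y z -> reachable x z.
Proof.
case=> h [n [[h0 hs] <-]] yz.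
exists (fun i => if i <= n then h i else z), n.+1; split; last by rewrite ltnn.
split=> // i; rewrite ltnS => lein; rewrite lein.
case: ltnP => [ltin|leni]; first exact: hs.
by have -> : i = n by lia.
Qed.

Lemma play_invariant (I : X -> Prop) h n :
  (forall x y, I x -> step x y -> I y) ->
  (forall i, i < n -> step (h i) (h i.+1)) -> I (h 0) -> I (h n).
Proof.
move=> Istep hs I0.
suff: forall i, i <= n -> I (h i) by exact.
by elim=> // i IH lt; apply: Istep (hs _ lt); apply: IH; exact: ltnW.
Qed.

(** Winning conditions concern plays from the initial position only; prefixing the play that reaches
    [y] brings [h] under them. *)
Lemma infinite_play_cat x y h : reachable x y -> infinite_play step y h ->
  exists n h', infinite_play step x h' /\ forall i, h' (n + i) = h i.
Proof.
case=> k [n [[k0 ks] kn]] [h0 hs].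
exists n, (fun i => if i < n then k i else h (i - n)); split; last first.
  by move=> i; rewrite ltnNge leq_addr addKn.
split; first by case: (posnP n) => // n0; rewrite h0 -kn n0.
move=> i /=; case: (ltngtP i.+1 n) => [lt|gt|eq].
- by apply: ks; exact: ltnW.
- by rewrite subSn.
- by rewrite eq subnn h0 -kn -eq; apply: ks; rewrite -eq.
Qed.

(** Dependent choice: an inaccessible point has an inaccessible successor. *)
Lemma not_acc_infinite_play x : ~ Acc (fun z y => step y z) x ->
  exists h, infinite_play step x h.
Proof.
move=> nx; pose bad y := ~ Acc (fun z y => step y z) y.
have next y : exists z, bad y -> bad z /\ step y z.
  have [by_|nby] := pselect (bad y); last by exists y.
  apply: contrapT => nz; apply: by_; constructor=> z yz.
  by apply: contrapT => bz; apply: nz; exists z.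
have [g gP] := choice next.
have bads i : bad (iter i g x) by elim: i => //= i /gP[].
by exists (fun i => iter i g x); split=> // i; case: (gP _ (bads i)).
Qed.
End Plays.

Lemma wo_no_descent (G : wotype) (r : nat -> G) :
  ~ forall i, wo_lt (r i.+1) (r i).
Proof.
move=> dr; suff H c : forall i, r i <> c by exact: (H (r 0) 0).
by elim: (wo_wf c) => {}c _ IH i ric; apply: (IH (r i.+1) _ i.+1); rewrite -?ric.
Qed.

(** * Winning positions *)

Section Winning.
Variable M : cgm.
Notation agt := 'I_(nagt M).
Notation fml := (formula M).
Implicit Types (A : {set agt}) (q : St M) (f g : fml) (P Q V C : player).
Implicit Types (X : set (St M)) (e : embgame M) (x : position M).

Lemma step_choice_inhabited A q : exists m : forall r, step_choice r A q, True.
Proof.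
have a i : {a : Act M | avail i q a} by apply: cid; exact: avail_nonempty.
by exists (fun r => match r return step_choice r A q with
  | Verifier => fun i _ => a i | Falsifier => fun _ i _ => a i end).
Qed.

(** [m] offers a choice for each role; [follows] binds the one of the role Eloise has and leaves the
    other player free, so both owners are treated alike. *)
Definition next_ok Q A q (m : forall r, step_choice r A q) X : Prop :=
  forall a r, follows Eloise Q (m Verifier) a ->
    follows Eloise (opp Q) (m Falsifier) r -> X (step_outcome a r).

(* As in [round_result], but with the sets [WC] and [WO] of states won on exit
   with the controller's and the other formula in place of these formulae. *)
Definition round_ok V C A (WC WO : set (St M)) q
    (m : forall r, emb_move r A q) X : Prop :=
  forall mv mf, follows Eloise V (m Verifier) mv ->
    follows Eloise (opp V) (m Falsifier) mf ->
    match mv, mf with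
    | Some a, Some r => X (step_outcome a r)
    | None, Some _ => if V == C then WC q else WO q
    | Some _, None => if opp V == C then WC q else WO q
    | None, None => WC q
    end.

(** Taking sets instead of exit formulae lets [win] pass in its own recursive values and remain
    structurally recursive. *)
Definition round_op V C A (WC WO : set (St M)) X : set (St M) :=
  [set q | exists m : forall r, emb_move r A q, round_ok V C WC WO m X].

Definition emb_win V C A (WC WO : set (St M)) : set (St M) :=
  match C with
  | Eloise => lfp (round_op V C A WC WO)
  | Abelard => gfp (round_op V C A WC WO)
  end.

Fixpoint win f Q : set (St M) :=
  match f with
  | Var p => [set q | wins_atom Eloise Q q p]
  | Neg f => win f (opp Q)
  | Or f g => match Q with
      | Eloise => win f Q `|` win g Q
      | Abelard => win f Q `&` win g Q
      end
  | Next A f => [set q | exists m : forall r, step_choice r A q, next_ok Q m (win f Q)]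
  | Until A f g => emb_win Q Q A (win g Q) (win f Q)
  | Release A f g => emb_win Q (opp Q) A (win g Q) (win f Q)
  end.

Definition win_at x := win (fmla x) (owner x) (state x).

Definition emb_op e := round_op (verifier e) (controller e) (coalition e)
  (win (ctl_fml e) (verifier e)) (win (opp_fml e) (verifier e)).

Definition emb_won e := emb_win (verifier e) (controller e) (coalition e)
  (win (ctl_fml e) (verifier e)) (win (opp_fml e) (verifier e)).

Definition emb_ok e q (m : forall r, emb_move r (coalition e) q) X : Prop :=
  forall mv mf, follows Eloise (verifier e) (m Verifier) mv ->
    follows Eloise (opp (verifier e)) (m Falsifier) mf ->
    match round_result mv mf with
    | inl f => win f (verifier e) q
    | inr q' => X q'
    end.

(** Translates the set-based operator into the [round_result] of the actual games. *)
Lemma emb_opP e X q :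
  emb_op e X q <-> exists m : forall r, emb_move r (coalition e) q, emb_ok m X.
Proof.
have same (mv : emb_move Verifier (coalition e) q)
    (mf : emb_move Falsifier (coalition e) q) :
    match round_result mv mf with
    | inl f => win f (verifier e) q | inr q' => X q' end =
    match mv, mf with
    | Some a, Some r => X (step_outcome a r)
    | None, Some _ => if verifier e == controller e
        then win (ctl_fml e) (verifier e) q else win (opp_fml e) (verifier e) q
    | Some _, None => if opp (verifier e) == controller e
        then win (ctl_fml e) (verifier e) q else win (opp_fml e) (verifier e) q
    | None, None => win (ctl_fml e) (verifier e) q
    end.
  by case: mv mf => [a|] [r|] //=; rewrite /exit_fml; case: ifP.
split=> -[m mP]; exists m => mv mf fv ff; have := mP mv mf fv ff; by rewrite same.
Qed.

Lemma emb_op_mono e : monotone (emb_op e).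
Proof.
move=> X Y XY q /emb_opP[m mP]; apply/emb_opP; exists m => mv mf fv ff.
by have := mP mv mf fv ff; case: round_result => // q'; apply: XY.
Qed.

Lemma emb_wonE e : emb_won e = match controller e with
  | Eloise => lfp (emb_op e) | Abelard => gfp (emb_op e) end.
Proof. by rewrite /emb_won /emb_op; case: controller. Qed.

Lemma embedded_at_win x e :
  embedded_at x = Some e -> win_at x <-> emb_won e (start e).
Proof. by case: x => Q q [] //= A f g [<-]. Qed.

Lemma round_result_exit e q (mv : emb_move Verifier (coalition e) q)
    (mf : emb_move Falsifier (coalition e) q) f :
  round_result mv mf = inl f -> f = ctl_fml e \/ f = opp_fml e.
Proof.
by case: mv mf => [a|] [r|] //= [<-]; rewrite /exit_fml; try case: ifP; auto.
Qed.

(** Abelard may end the game at once, and as controller he has precedence. *)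
Lemma emb_op_opp_ctl e X q : controller e = Abelard ->
  emb_op e X q -> win (ctl_fml e) (verifier e) q.
Proof.
move=> eC /emb_opP[m mP]; case eV: (verifier e).
  have free : follows Eloise (opp (verifier e)) (m Falsifier) None.
    by rewrite /follows eV.
  have := mP _ _ (fun=> erefl) free.
  by case: (m Verifier) => [a|] /=; rewrite /exit_fml ?eV ?eC.
have free : follows Eloise (verifier e) (m Verifier) None by rewrite /follows eV.
have := mP _ _ free (fun=> erefl).
by case: (m Falsifier) => [a|] /=; rewrite /exit_fml ?eV ?eC.
Qed.

(** Let Abelard go on: if Eloise went on too, the next state would lie in [set0], so her move must
    be to end. *)
Lemma emb_op_ctl0 e q : controller e = Eloise ->
  emb_op e set0 q -> win (ctl_fml e) (verifier e) q.
Proof.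
move=> eC /emb_opP[m mP]; have [s _] := step_choice_inhabited (coalition e) q.
case eV: (verifier e).
  have free : follows Eloise (opp (verifier e)) (m Falsifier) (Some (s Falsifier)).
    by rewrite /follows eV.
  have := mP _ _ (fun=> erefl) free.
  by case: (m Verifier) => [a|] /=; rewrite /exit_fml ?eV ?eC.
have free : follows Eloise (verifier e) (m Verifier) (Some (s Verifier)).
  by rewrite /follows eV.
have := mP _ _ free (fun=> erefl).
by case: (m Falsifier) => [a|] /=; rewrite /exit_fml ?eV ?eC.
Qed.

Lemma emb_op_ctl e X q : controller e = Eloise ->
  win (ctl_fml e) (verifier e) q -> emb_op e X q.
Proof.
move=> eC wq; apply/emb_opP; exists (fun=> None) => mv mf.
case eV: (verifier e) wq => wq; rewrite /follows.
  by move=> -> // _; case: mf => //=; rewrite /exit_fml ?eV ?eC.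
by move=> _ -> //; case: mv => //=; rewrite /exit_fml ?eV ?eC.
Qed.

(** Eloise goes on with any available choice: either Abelard ends at the controller's formula, or
    the next state is unconstrained. *)
Lemma emb_op_oppT e q : controller e = Abelard ->
  win (ctl_fml e) (verifier e) q -> emb_op e setT q.
Proof.
move=> eC wq; have [s _] := step_choice_inhabited (coalition e) q.
apply/emb_opP; exists (fun r => Some (s r)) => mv mf.
case eV: (verifier e) wq => wq; rewrite /follows.
  by move=> -> // _; case: mf => //=; rewrite /exit_fml eV eC.
by move=> _ -> //; case: mv => //=; rewrite /exit_fml eV eC.
Qed.

(** * From strategies to winning positions *)

Section ClosedSets.
Variables (S : base_strategy M) (R : position M -> Prop).
Hypothesis R_step : forall x y, R x -> base_step Eloise S x y -> R y.
Hypothesis R_atom :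
  forall Q q p, R (Pos Q q (Var p)) -> wins_atom Eloise Q q p.
Hypothesis R_emb : forall x e, R x -> embedded_at x = Some e ->
  (forall f Q q, f = ctl_fml e \/ f = opp_fml e -> R (Pos Q q f) -> win f Q q) ->
  emb_won e (start e).

(** Common to both games: [R] will be the set of positions reachable under a winning strategy. Only
    [R_emb], which receives the induction hypothesis for the exit formulae, depends on the kind of
    game. *)
Lemma win_of_closed f Q q : R (Pos Q q f) -> win f Q q.
Proof.
elim: f Q q => [p|f IH|f IHf g IHg|A f IH|A f IHf g IHg|A f IHf g IHg] Q q Rx /=.
- exact: R_atom Rx.
- by apply: IH; apply: R_step Rx _; constructor.
- have st b : follows Eloise Q (st_disj S q f g) b ->
      R (Pos Q q (if b then f else g)).
    by move=> fb; apply: R_step Rx _; constructor.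
  case: Q {Rx} st => st.
    by have := st _ (fun=> erefl); case: (st_disj S q f g); [left; apply: IHf|right; apply: IHg].
  by split; [apply: IHf; exact: (st true)|apply: IHg; exact: (st false)].
- exists (fun r => st_next S r A q f) => a r fa fr; apply: IH.
  by apply: R_step Rx _; constructor.
- have := R_emb Rx erefl; apply=> h P s /= [] ->; [exact: IHg|exact: IHf].
- have := R_emb Rx erefl; apply=> h P s /= [] ->; [exact: IHg|exact: IHf].
Qed.
End ClosedSets.

(** * Unbounded winning strategies *)

Section UnboundedSoundness.
Variables (S : ustrategy M) (q0 : St M) (phi : fml).
Hypothesis S_wins : uwinning Eloise S q0 phi.
Notation init := (UPos (Pos Eloise q0 phi)).
Notation reach := (reachable (ustep Eloise S) init).

Lemma reach_uexit e q mv mf f : reach (UEmb e q) ->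
  follows Eloise (verifier e) (u_emb S Verifier e q) mv ->
  follows Eloise (opp (verifier e)) (u_emb S Falsifier e q) mf ->
  round_result mv mf = inl f -> reach (UPos (Pos (verifier e) q f)).
Proof.
move=> rq fv ff rr; apply: reachable_step rq _.
by have := ustep_round fv ff; rewrite rr.
Qed.

(** Otherwise some play would stay in [e] forever, and its controller Eloise would lose. *)
Lemma uwinning_acc e q : controller e = Eloise -> reach (UEmb e q) ->
  Acc (fun s' s => ustep Eloise S (UEmb e s) (UEmb e s')) q.
Proof.
move=> eC rq; apply: contrapT => nacc.
have [h [h0 hs]] :=
  not_acc_infinite_play (step := fun s s' => ustep Eloise S (UEmb e s) (UEmb e s')) nacc.
have [|n [k [kP kh]]] := infinite_play_cat (h := UEmb e \o h) rq.
  by split=> /=; [rewrite h0|].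
have [_ /(_ _ kP)[e' [N [kN eC']]]] := S_wins.
have [s] := kN (n + N) (leq_addl _ _).
by rewrite kh => -[ee _]; move: eC'; rewrite -ee eC.
Qed.

Lemma uwinning_win : win phi Eloise q0.
Proof.
apply: (@win_of_closed S (fun x => reach (UPos x))); last exact: reachable_refl.
- by move=> x y rx xy; apply: reachable_step rx _; constructor.
- by move=> Q q p [h [n [hP hn]]]; have [H _] := S_wins; apply: H hP _ _ _ hn.
move=> x e rx xe IH; have rs : reach (UEmb e (start e)).
  by apply: reachable_step rx _; constructor.
have op_of Z q : reach (UEmb e q) ->
    (forall q', ustep Eloise S (UEmb e q) (UEmb e q') -> Z q') -> emb_op e Z q.
  move=> rq Zq; apply/emb_opP; exists (fun r => u_emb S r e q) => mv mf fv ff.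
  case rr: (round_result mv mf) => [f|q'].
    by apply: IH; [exact: round_result_exit rr|exact: reach_uexit rq fv ff rr].
  by apply: Zq; have := ustep_round fv ff; rewrite rr.
rewrite emb_wonE; case eC: (controller e); last first.
  (* The reachable states of [e] form a post-fixed point. *)
  exists [set q | reach (UEmb e q)] => // q rq; apply: op_of => // q' qq'.
  exact: reachable_step rq qq'.
elim: (uwinning_acc eC rs) (rs) => q _ IHq rq.
apply: lfp_closed (@emb_op_mono e) _ _; apply: op_of => // q' qq'.
by apply: IHq => //; exact: reachable_step rq qq'.
Qed.
End UnboundedSoundness.

(** * Bounded winning strategies, by induction on time limits *)

Section BoundedSoundness.
Variables (G : wotype) (S : bstrategy M G) (q0 : St M) (phi : fml).
Hypothesis no_inj : forall g : G -> St M, ~ injective g.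
Hypothesis S_wins : bwinning Eloise S q0 phi.
Notation reach := (reachable (bstep Eloise S) (BPos G (Pos Eloise q0 phi))).

Lemma zero_succ_limit (c : G) :
  is_zero c \/ (exists d, is_succ_of c d) \/ is_limit c.
Proof.
have [|nz] := pselect (is_zero c); first by left.
have [|ns] := pselect (exists d, is_succ_of c d); first by right; left.
by right; right.
Qed.

Lemma bwinning_win : win phi Eloise q0.
Proof.
apply: (@win_of_closed S (fun x => reach (BPos G x))); last exact: reachable_refl.
- by move=> x y rx xy; apply: reachable_step rx _; constructor.
- by move=> Q q p [h [n [hP hn]]]; apply: S_wins hP _ _ _ hn.
move=> x e rx xe IH.
have op_of c0 c q Z : ~ is_zero c -> reach (BEmb e c0 c q) ->
    (forall q', (forall c', is_succ_of c c' -> reach (BEmb e c0 c' q')) ->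
       (forall c', is_limit c -> wo_lt c' c ->
          follows Eloise (controller e) (b_timer S e c q') c' ->
          reach (BEmb e c0 c' q')) -> Z q') -> emb_op e Z q.
  move=> nz rq Zq; apply/emb_opP.
  exists (fun r => b_emb Eloise S r e c0 c q) => mv mf fv ff.
  case rr: (round_result mv mf) => [f|q'].
    apply: IH; first exact: round_result_exit rr.
    by apply: reachable_step rq _; exact: bstep_exit fv ff rr.
  apply: Zq => [c' cc'|c' lc cc' fc']; apply: reachable_step rq _.
    exact: bstep_succ fv ff rr cc'.
  exact: bstep_limit fv ff rr lc cc' fc'.
have win0 c0 c q : is_zero c -> reach (BEmb e c0 c q) ->
    win (ctl_fml e) (verifier e) q.
  move=> z rq; apply: IH; first by left.
  by apply: reachable_step rq _; exact: bstep_zero.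
rewrite emb_wonE; case eC: (controller e).
  suff H c c0 q : reach (BEmb e c0 c q) -> lfp (emb_op e) q.
    apply: (H (b_limit S e) (b_limit S e)); apply: reachable_step rx _.
    by constructor.
  elim: (wo_wf c) q => {}c _ IHc q rq; apply: lfp_closed (@emb_op_mono e) _ _.
  have [z|nz] := pselect (is_zero c).
    by apply: emb_op_ctl => //; exact: win0 z rq.
  apply: (op_of _ _ _ _ nz rq) => q' rsucc rlim.
  have [//|[[d cd]|lc]] := zero_succ_limit c.
    by apply: IHc (rsucc _ cd); case: cd.
  have lt := b_timer_lt S e q' lc; exact: IHc lt _ (rlim _ lc lt (fun=> erefl)).
apply: gfp_stage (@emb_op_mono e) no_inj _ => c.
(* As controller, Abelard may open with any limit, so the start is tested against every dual
   stage. *)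
suff H d c0 q : reach (BEmb e c0 d q) -> ~ stage (dual (emb_op e)) d q.
  apply: (H _ c); apply: reachable_step rx _; constructor=> //.
  by rewrite /follows eC.
have mdual := monotone_dual (@emb_op_mono e).
elim: (wo_wf d) q => {}d _ IHd q rq; rewrite stageE; apply.
have [z|nz] := pselect (is_zero d).
  (* No stage precedes zero, so every next state is allowed and winning the forced exit suffices. *)
  apply: emb_op_mono (emb_op_oppT eC (win0 _ _ _ z rq)) => q' _ [d' d'd].
  by case: (z _ d'd).
apply: (op_of _ _ _ _ nz rq) => q' rsucc rlim [d' d'd].
have [//|[[b db]|ld]] := zero_succ_limit d.
  (* The new limit is the predecessor [b], and any [d'] below [d] is at most [b]. *)
  move=> d'q'; have [bd /(_ _ d'd) d'b] := db; apply: IHd bd _ (rsucc _ db) _.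
  apply: stage_le mdual _ _ _ _ d'q' => bd'.
  case: d'b => [e'|d'b]; last exact: wo_irr (wo_trans bd' d'b).
  by move: bd'; rewrite e'; exact: wo_irr.
(* At a limit Abelard sets the timer, so he can choose [d'] itself. *)
by apply: IHd d'd _ (rlim _ ld d'd _); rewrite /follows eC.
Qed.
End BoundedSoundness.

(** * From winning positions to strategies *)

Section Synthesis.
Variable G : wotype.
Hypothesis no_inj : forall g : G -> St M, ~ injective g.
Hypothesis G_inhabited : inhabited G.

Lemma exists_rank : exists rk : embgame M -> St M -> G, forall e q,
  lfp (emb_op e) q -> stage (emb_op e) (rk e q) q /\
    forall d, stage (emb_op e) d q -> ~ wo_lt d (rk e q).
Proof.
have [c0] := G_inhabited.
have ex (eq : embgame M * St M) : exists c : G, lfp (emb_op eq.1) eq.2 ->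
    stage (emb_op eq.1) c eq.2 /\
    forall d, stage (emb_op eq.1) d eq.2 -> ~ wo_lt d c.
  case: eq => e q /=; have [lq|] := pselect (lfp (emb_op e) q); last by exists c0.
  by have [c cP] := lfp_least_stage (@emb_op_mono e) no_inj lq; exists c.
have [rk rkP] := choice ex.
by exists (fun e q => rk (e, q)) => e q; exact: rkP (e, q).
Qed.

Definition rank := sval (cid exists_rank).

Lemma rank_stage e q : lfp (emb_op e) q -> stage (emb_op e) (rank e q) q.
Proof. by move=> lq; have [] := svalP (cid exists_rank) e q lq. Qed.

Lemma rank_le e q c : stage (emb_op e) c q -> ~ wo_lt c (rank e q).
Proof.
move=> cq; have lq := stage_lfp (@emb_op_mono e) cq.
by have [_] := svalP (cid exists_rank) e q lq; apply.
Qed.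

(** When Eloise controls, the rank must drop, which excludes endless play; when Abelard controls,
    staying among won states is enough. *)
Definition progress e q : set (St M) :=
  [set q' | emb_won e q' /\
            (controller e = Eloise -> wo_lt (rank e q') (rank e q))].

Lemma exists_good_move e q :
  exists m : forall r, emb_move r (coalition e) q,
    emb_won e q -> emb_ok m (progress e q).
Proof.
have [wq|] := pselect (emb_won e q); last by exists (fun=> None).
suff /emb_opP[m mP] : emb_op e (progress e q) q by exists m.
move: wq; rewrite /progress emb_wonE; case eC: (controller e) => wq.
  (* Unfolding the least stage of [q] yields a move into strictly earlier stages, which bound the
     new rank. *)
  have := rank_stage wq; rewrite stageE; apply: emb_op_mono => q' [d dq dq'].
  split; first exact: stage_lfp (@emb_op_mono e) _ _ dq'.
  move=> _; have [lt|[->//|lt]] := wo_total (rank e q') d.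
    exact: wo_trans lt dq.
  by case: (rank_le dq').
by apply: emb_op_mono (gfp_unfold (@emb_op_mono e) wq) => q' wq'; split.
Qed.

Definition good_move e q := sval (cid (exists_good_move e q)).

Lemma good_moveP e q : emb_won e q -> emb_ok (good_move e q) (progress e q).
Proof. exact: svalP (cid (exists_good_move e q)). Qed.

Lemma exists_good_choice Q A q f : exists m : forall r, step_choice r A q,
  win (Next A f) Q q -> next_ok Q m (win f Q).
Proof.
have [[m mP]|nw] := pselect (win (Next A f) Q q); first by exists m.
by have [m _] := step_choice_inhabited A q; exists m => /nw.
Qed.

Definition good_choice Q A q f := sval (cid (exists_good_choice Q A q f)).

Lemma good_choiceP Q A q f :
  win (Next A f) Q q -> next_ok Q (good_choice Q A q f) (win f Q).
Proof. exact: svalP (cid (exists_good_choice Q A q f)). Qed.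

(** The role determines the owner of a next-time position: Eloise if she is verifier, Abelard if she
    is falsifier. *)
Definition good_base : base_strategy M := BaseStrategy
  (fun q f _ => `[< win f Eloise q >])
  (fun r A q f => match r return step_choice r A q with
    | Verifier => good_choice Eloise A q f Verifier
    | Falsifier => good_choice Abelard A q f Falsifier
    end).

Lemma good_base_win x y :
  win_at x -> base_step Eloise good_base x y -> win_at y.
Proof.
move=> wx xy; case: xy wx => // [Q q f g b fb|Q q A f a r fa fr] wx.
  rewrite /win_at /=; move: wx fb; rewrite /win_at /follows /=.
  case: Q => [w /(_ erefl) ->|[wf wg] _]; last by case: b.
  by case: asboolP w => // nw [].
rewrite /win_at /=; apply: (good_choiceP wx).
  by case: Q fa {fr wx} => fa // /fa.
by case: Q fr {fa wx} => fr // /fr.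
Qed.

Definition good_ustrategy : ustrategy M :=
  UStrategy good_base (fun r e q => good_move e q r).

Definition uwon (x : uconf M) : Prop :=
  match x with UPos x => win_at x | UEmb e q => emb_won e q end.

Lemma good_ustep_emb e q y : emb_won e q ->
  ustep Eloise good_ustrategy (UEmb e q) y ->
  match y with
  | UPos x => win_at x
  | UEmb e' q' => e' = e /\ progress e q q'
  end.
Proof.
move=> wq xy; move: {-1}(UEmb e q) (erefl (UEmb e q)) xy => z ez xy.
case: xy ez => // e' q' mv mf fv ff [ee eq]; subst e' q'.
by have := good_moveP wq fv ff; case: round_result.
Qed.

Lemma good_ustep_won (x y : uconf M) :
  uwon x -> ustep Eloise good_ustrategy x y -> uwon y.
Proof.
move=> wx xy; case: x wx xy => [x|e q] /= wx xy.
  move: {-1}(UPos x) (erefl (UPos x)) xy => z ez xy.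
  case: xy ez => // [x' y' xy' [ex]|x' e xe [ex]]; subst x'.
    exact: good_base_win wx xy'.
  exact/(embedded_at_win xe).
by have := good_ustep_emb wx xy; case: y {xy} => // e' q' [-> []].
Qed.

Fixpoint fml_size f : nat :=
  match f with
  | Var _ => 0
  | Neg f | Next _ f => (fml_size f).+1
  | Or f g | Until _ f g | Release _ f g => (fml_size f + fml_size g).+1
  end.

(** Doubling leaves an odd value for an embedded game, strictly between its until or release formula
    and its exit formulae. *)
Definition uconf_size (x : uconf M) : nat :=
  match x with
  | UPos x => (fml_size (fmla x)).*2
  | UEmb e _ => (fml_size (ctl_fml e) + fml_size (opp_fml e)).*2.+1
  end.

Lemma ustep_size S (x y : uconf M) : ustep Eloise S x y ->
  uconf_size y < uconf_size x \/
  exists e q q', x = UEmb e q /\ y = UEmb e q'.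
Proof.
case=> [_ _ [Q q f|Q q f g b _|Q q A f a r _ _]|{}x e xe|e q mv mf _ _] /=.
- by left; lia.
- by left; case: b; lia.
- by left; lia.
- by left; case: x xe => Q q [] //= A f g [<-] /=; lia.
- case rr: round_result => [f|q'] /=; last by right; exists e, q, q'.
  by left; have [->|->] := round_result_exit rr; lia.
Qed.

(** Sizes cannot drop forever; once they stop dropping, each step is a round of the same embedded
    game. *)
Lemma infinite_uplay_emb S (h : nat -> uconf M) :
  (forall i, ustep Eloise S (h i) (h i.+1)) ->
  exists e N, forall i, N <= i -> exists q, h i = UEmb e q.
Proof.
move=> hs; have [n] := ubnP (uconf_size (h 0)).
elim: n h hs => // n IH h hs hn.
have [[i lti]|nlt] := pselect (exists i, uconf_size (h i) < uconf_size (h 0)).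
  have [||e [N hN]] := IH (fun j => h (i + j)).
  - by move=> j; rewrite addnS.
  - by rewrite addn0; lia.
  exists e, (i + N) => j ltj; have -> : j = i + (j - i) by lia.
  by apply: hN; lia.
have size_ge i : uconf_size (h 0) <= uconf_size (h i).
  by rewrite leqNgt; apply/negP => lti; apply: nlt; exists i.
have [|[e [q [q' [h0 h1]]]]] := ustep_size (hs 0).
  by have := size_ge 1; lia.
exists e, 0 => i _; elim: i => [|i [s hi]]; first by exists q.
have [|[e' [r [r' [hi' hi1]]]]] := ustep_size (hs i).
  by have := size_ge i.+1; rewrite hi h0 /=; lia.
by move: hi'; rewrite hi hi1 => -[-> _]; exists r'.
Qed.

Lemma good_ustrategy_wins q f :
  win f Eloise q -> uwinning Eloise good_ustrategy q f.
Proof.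
move=> wq; split=> [h n [h0 hs] Q q' p hn|h [h0 hs]].
  have : uwon (h n) by apply: play_invariant good_ustep_won hs _; rewrite h0.
  by rewrite hn.
have hwon i : uwon (h i).
  by apply: play_invariant good_ustep_won (fun j _ => hs j) _; rewrite h0.
have [e [N hN]] := infinite_uplay_emb hs; exists e, N; split=> //.
case eC: (controller e) => //; exfalso.
have [s sP] : exists s : nat -> St M, forall i, h (N + i) = UEmb e (s i).
  have ex i : exists q', h (N + i) = UEmb e q' by apply: hN; exact: leq_addr.
  by have [s sP] := choice ex; exists s.
(* If Eloise controlled [e], the ranks along the play would descend forever. *)
apply: (@wo_no_descent G (fun i => rank e (s i))) => i.
have := hwon (N + i); have := hs (N + i); rewrite -addnS !sP => st wi.
by have [_ [_]] := good_ustep_emb wi st; apply.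
Qed.

(** The rank is the intended value. The fallbacks serve [b_timer_lt], which must hold at every
    limit, also where the rank is not below it. *)
Definition good_timer e (c : G) q : G :=
  match pselect (wo_lt (rank e q) c) with
  | left _ => rank e q
  | right _ => match pselect (exists d, wo_lt d c) with
      | left ex => sval (cid ex)
      | right _ => c
      end
  end.

Lemma good_timer_lt e (c : G) q : is_limit c -> wo_lt (good_timer e c q) c.
Proof.
move=> [nz _]; rewrite /good_timer; case: pselect => // _.
case: pselect => [ex|nex]; first exact: svalP (cid ex).
by case: nz => d dc; apply: nex; exists d.
Qed.

Definition good_bstrategy : bstrategy M G := BStrategy good_base
  (fun e => rank e (start e)) good_timer_lt
  (fun r e _ q => good_move e q r) (fun r e _ _ q => good_move e q r).

(** Invariant: under Eloise's control, the remaining time never falls short of the rank. *)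
Definition bwon (x : bconf M G) : Prop :=
  match x with
  | BPos x => win_at x
  | BEmb e _ c q =>
      emb_won e q /\ (controller e = Eloise -> ~ wo_lt c (rank e q))
  end.

(** The forced exit is safe: with Eloise in control the state lies in stage zero, and Abelard in
    control could have ended there anyway. *)
Lemma emb_won_zero e q (c : G) : is_zero c -> emb_won e q ->
  (controller e = Eloise -> ~ wo_lt c (rank e q)) ->
  win (ctl_fml e) (verifier e) q.
Proof.
move=> z; rewrite emb_wonE; case eC: (controller e) => wq le; last first.
  exact: emb_op_opp_ctl eC (gfp_unfold (@emb_op_mono e) wq).
have rq := stage_le (@emb_op_mono e) (le erefl) (rank_stage wq).
apply: emb_op_ctl0 eC _; move: rq; rewrite stageE.
by apply: emb_op_mono => q' [d /z].
Qed.

Lemma good_bstep_won (x y : bconf M G) :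
  bwon x -> bstep Eloise good_bstrategy x y -> bwon y.
Proof.
move=> wx xy; case: xy wx => {x y} /=.
- by move=> x y xy wx; exact: good_base_win wx xy.
- move=> x e c0 xe fc wx; split; first exact/(embedded_at_win xe).
  by move=> eC; rewrite (fc eC); exact: wo_irr.
- by move=> e c0 c q z [wq le]; exact: emb_won_zero z wq le.
- move=> e c0 c q mv mf f _; rewrite /b_emb /= !if_same => fv ff rr [wq _].
  by have := good_moveP wq fv ff; rewrite rr.
- move=> e c0 c q mv mf q' c'; rewrite /b_emb /= !if_same => fv ff rr cc' [wq le].
  have := good_moveP wq fv ff; rewrite rr => -[wq' lt]; split=> // eC c'r.
  have [_ /(_ (rank e q')) H] := cc'.
  (* The new rank is strictly below [c], hence at most its predecessor [c']. *)
  have rc := wo_lt_le_trans (lt eC) (le eC).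
  case: (H rc) => [e'|rc']; last exact: wo_irr (wo_trans rc' c'r).
  by move: c'r; rewrite e'; exact: wo_irr.
- move=> e c0 c q mv mf q' c'; rewrite /b_emb /= !if_same => fv ff rr lc cc' fc' [wq le].
  have := good_moveP wq fv ff; rewrite rr => -[wq' lt]; split=> // eC.
  have rc := wo_lt_le_trans (lt eC) (le eC).
  by rewrite (fc' eC) /good_timer; case: pselect => // _; exact: wo_irr.
Qed.

Lemma good_bstrategy_wins q f :
  win f Eloise q -> bwinning Eloise good_bstrategy q f.
Proof.
move=> wq h n [h0 hs] Q q' p hn.
have : bwon (h n) by apply: play_invariant good_bstep_won hs _; rewrite h0.
by rewrite hn.
Qed.
End Synthesis.

Lemma sat_uP q f : sat_u q f <-> win f Eloise q.
Proof.
split=> [[S /uwinning_win //]|wq].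
have H := pow_ordinal_inhabited (St M).
by exists (good_ustrategy (@pow_ordinal_no_inj (St M)) H); exact: good_ustrategy_wins.
Qed.

Lemma sat_bP q f : sat_b q f <-> win f Eloise q.
Proof.
split=> [[S]|wq]; first exact/bwinning_win/pow_ordinal_no_inj.
have H := pow_ordinal_inhabited (St M).
by exists (good_bstrategy (@pow_ordinal_no_inj (St M)) H); exact: good_bstrategy_wins.
Qed.
End Winning.

Theorem theorem4p26 (M : cgm) (q : St M) (phi : formula M) :
  sat_u q phi <-> sat_b q phi.
Proof. by rewrite sat_uP sat_bP. Qed.
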